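(* Let $S\in\mathsf{SS}^{\mathrm{ns}}_{\leq n}$, let $M$ be a finite-dimensional left $A_S$-module, let $\nabla\colon M\to\Omega_S^1\otimes_{A_S}M$ be a left connection, and for $e\in S_1$ define $T_e:=(\varphi^e\otimes\mathrm{id}_M)\circ\nabla\colon M\to M$. Then: (1) For all $x\in M$, $\nabla(x)=\sum_{e\in S_1}\omega_e\otimes T_e(x)$, with $T_e(x)\in M_{d_0(e)}$ for every $x\in M$, and this expansion (with coefficients in $M_{d_0(e)}$) is unique. (2) For $f\in A_S$ and $x\in M$, $$T_e(fx)=\partial_e(f)\cdot x+f(d_1(e))\,T_e(x),\qquad \partial_e(f):=\varphi^e(df)=\bigl(f(d_0(e))-f(d_1(e))\bigr)\delta_{d_0(e)}.$$ (3) For each $e\in S_1$ there is a unique map $R_e\in\operatorname{Hom}_\Bbbk(M_{d_1(e)},M_{d_0(e)})$ such that $T_e=\delta_{d_0(e)}-R_e\delta_{d_1(e)}$. Conversely, given a family $\{R_e\in\operatorname{Hom}_\Bbbk(M_{d_1(e)},M_{d_0(e)})\}_{e\in S_1}$, the formula $$\nabla(x):=\sum_{e\in S_1}\omega_e\otimes\bigl(\delta_{d_0(e)}-R_e\delta_{d_1(e)}\bigr)(x)$$ defines a unique left connection on $M$.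
   Context: $\Bbbk$ is a field of characteristic different from $2$. $\mathsf{SS}^{\mathrm{ns}}_{\leq n}$ is the category of $n$-truncated semisimplicial sets $S$ with finitely many simplices such that every simplex is determined by its ordered tuple of vertices and every positive-dimensional simplex has pairwise distinct vertices. An edge $e=[x,y]\in S_1$ has source $d_1(e)=x$ and target $d_0(e)=y$. $A_S=\Omega_S^0=\Bbbk(S_0)$ is the algebra of functions on $S_0$ with indicator idempotents $\delta_v$. $\Omega_S^1$ is the $A_S$-bimodule with $\Bbbk$-basis $\{\omega_e\}_{e\in S_1}$, $f\omega_e g=f(d_1(e))g(d_0(e))\omega_e$, and $d\colon A_S\to\Omega_S^1$ is $df=\sum_{e\in S_1}(f(d_0(e))-f(d_1(e)))\omega_e$. For a left $A_S$-module $M$, $M_v:=\delta_vM$, so $M=\bigoplus_vM_v$; $\delta_v$ also denotes the projection $M\to M_v\subseteq M$. A left connection on $M$ is a $\Bbbk$-linear map $\nabla\colon M\to\Omega_S^1\otimes_{A_S}M$ with $\nabla(fx)=df\otimes x+f\cdot\nabla(x)$ for $f\in A_S$, $x\in M$. For $e\in S_1$, $\varphi^e\colon\Omega_S^1\to A_S$ is the right $A_S$-linear map with $\varphi^e(\omega_{e'})=\delta_{d_0(e)}$ if $e'=e$ and $0$ otherwise; $\varphi^e\otimes\mathrm{id}_M\colon\Omega_S^1\otimes_{A_S}M\to M$ denotes the map $\alpha\otimes m\mapsto\varphi^e(\alpha)m$. *)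

(* Defs.v *)
From HB Require Import structures.
From mathcomp Require Import all_boot all_order all_algebra.
From mathcomp Require Import boolp.
From mathcomp Require freeg.

Set Implicit Arguments.
Unset Strict Implicit.
Unset Printing Implicit Defensive.

Import GRing.Theory.
Local Open Scope ring_scope.

HB.mixin Record Lmodule_isBimodule (R A : pzRingType) X of GRing.Lmodule R X := {
  ract : X -> A -> X;
  ractDl : forall a, {morph ract^~ a : x y / x + y};
  ractDr : forall x, {morph ract x : a b / a + b};
  ract1 : forall x, ract x 1 = x;
  ractA : forall x a b, ract (ract x a) b = ract x (a * b);
  scale_ract : forall r x a, ract (r *: x) a = r *: ract x a
}.

#[short(type="bimodType")]
HB.structure Definition Bimodule (R A : pzRingType) :=
  {X of Lmodule_isBimodule R A X & GRing.Lmodule R X}.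

Section Tensor.
Variables (R A : pzRingType) (X : bimodType R A) (M : lmodType A).
Import freeg.
Local Open Scope quotient_scope.

Definition free_prod := {freeg (X * M)%type / int}.
HB.instance Definition _ := GRing.Zmodule.on free_prod.

Inductive tensor_rel : free_prod -> Prop :=
| tensor_rel0 : tensor_rel 0
| tensor_relB u v : tensor_rel u -> tensor_rel v -> tensor_rel (u - v)
| tensor_relDl w w' m :
    tensor_rel (<< (w + w', m) >> - (<< (w, m) >> + << (w', m) >>))
| tensor_relDr w m m' :
    tensor_rel (<< (w, m + m') >> - (<< (w, m) >> + << (w, m') >>))
| tensor_relA w a m :
    tensor_rel (<< (ract w a, m) >> - << (w, a *: m) >>).

Definition tensor_ker (u : free_prod) : bool := `[< tensor_rel u >].

Fact tensor_ker_closed : zmod_closed tensor_ker.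
Proof.
split=> [|u v /asboolP ru /asboolP rv]; apply/asboolP.
  exact: tensor_rel0.
exact: tensor_relB.
Qed.
HB.instance Definition _ :=
  GRing.isZmodClosed.Build free_prod tensor_ker tensor_ker_closed.



Definition tensor :=
  ring_quotient.Quotient.quot (GRing.ZmodClosed.clone free_prod tensor_ker _).
HB.instance Definition _ := GRing.Zmodule.on tensor.

Definition tmul (w : X) (m : M) : tensor := \pi_tensor << (w, m) >>.

Fact pi_tensorB : zmod_morphism (\pi_tensor : free_prod -> tensor).
Proof. by move=> u v; rewrite !piE. Qed.
HB.instance Definition _ :=
  GRing.isZmodMorphism.Build free_prod tensor \pi_tensor pi_tensorB.

Fact pi_tensor_eq (u v : free_prod) :
  tensor_rel (u - v) -> \pi_tensor u = \pi_tensor v.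
Proof.
by move=> r; apply/eqP; rewrite -ring_quotient.Quotient.idealrBE; apply/asboolP.
Qed.

Lemma tmulDl w w' m : tmul (w + w') m = tmul w m + tmul w' m.
Proof. by rewrite /tmul -raddfD; apply/pi_tensor_eq/tensor_relDl. Qed.

Lemma tmulDr w m m' : tmul w (m + m') = tmul w m + tmul w m'.
Proof. by rewrite /tmul -raddfD; apply/pi_tensor_eq/tensor_relDr. Qed.

Lemma tmulA w a m : tmul (ract w a) m = tmul w (a *: m).
Proof. exact/pi_tensor_eq/tensor_relA. Qed.

Lemma tensor_ind (P : tensor -> Prop) :
  P 0 -> (forall t u, P t -> P u -> P (t - u)) -> (forall w m, P (tmul w m)) ->
  forall t, P t.
Proof.
move=> P0 PB Pt t.
have PN u : P u -> P (- u) by move=> Pu; rewrite -[- u]add0r; apply: PB.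
have PD u v : P u -> P v -> P (u + v).
  by move=> Pu Pv; rewrite -[v]opprK; apply: PB => //; apply: PN.
rewrite -[t]reprK -[repr t]freeg_sumE raddf_sum /=.
elim/big_ind: _ => // -[w m] _.
have PM n u : P u -> P (u *+ n).
  by move=> Pu; elim: n => [|n IHn]; rewrite ?mulr0n // mulrS; apply: PD.
have PZ z u : P u -> P (u *~ z).
  by case: z => n Pu; [apply: PM | apply: PN; apply: PM].
rewrite (_ : << _ *g (w, m) >> =
  (<< (w, m) >> : free_prod) *~ coeff (w, m) (repr t)); last first.
  by rewrite freegU_mulz intz.
by rewrite raddfMz; apply: PZ; apply: Pt.
Qed.

Section Lift.
Variable V : zmodType.

Definition balanced (f : X -> M -> V) : Prop :=
  [/\ forall m, {morph f^~ m : w w' / w + w'},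
      forall w, {morph f w : m m' / m + m'} &
      forall w a m, f (ract w a) m = f w (a *: m)].

(* The additive map w ⊗ m |-> f w m; meaningful when f is balanced. *)
Definition tlift (f : X -> M -> V) (t : tensor) : V :=
  fglift (fun p => f p.1 p.2 : zmodule V) (repr t).

Variable f : X -> M -> V.
Hypothesis fP : balanced f.
Let F (u : free_prod) : zmodule V := fglift (fun p => f p.1 p.2 : zmodule V) u.

Let FB : zmod_morphism F.
Proof. exact: lift_is_additive. Qed.

Let FD u v : F (u + v) = F u + F v.
Proof.
have F0 : F 0 = 0 by rewrite -[0]subr0 FB subrr.
have FN w : F (- w) = - F w by rewrite -[- w]add0r FB F0 add0r.
by rewrite -[v]opprK FB FN !opprK.
Qed.

Let FU w m : F << (w, m) >> = f w m.
Proof. by rewrite /F liftU scale1r. Qed.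

Let F_rel u : tensor_rel u -> F u = 0.
Proof.
case: fP => fDl fDr fA; elim=> [|x y _ Fx _ Fy|w w' m|w m m'|w a m].
- by rewrite -[0]subr0 FB subrr.
- by rewrite FB Fx Fy subrr.
- by rewrite FB FD !FU fDl; apply: subrr.
- by rewrite FB FD !FU fDr; apply: subrr.
- by rewrite FB !FU fA; apply: subrr.
Qed.

Let F_pi u : tlift f (\pi_tensor u) = F u.
Proof.
apply/eqP; rewrite -subr_eq0; apply/eqP; rewrite -[LHS]FB; apply/F_rel/asboolP.
by have := reprK (\pi_tensor u) => /eqP; rewrite -ring_quotient.Quotient.idealrBE.
Qed.

Lemma tlift_tmul w m : tlift f (tmul w m) = f w m.
Proof. by rewrite F_pi FU. Qed.

Lemma tliftB : zmod_morphism (tlift f).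
Proof.
by move=> t u; rewrite -[t]reprK -[u]reprK -raddfB !F_pi FB.
Qed.

Lemma tlift0 : tlift f 0 = 0.
Proof. by rewrite -[X in tlift f X](subrr 0) tliftB subrr. Qed.

Lemma tliftD : {morph tlift f : t u / t + u}.
Proof. by move=> t u; rewrite -[t]reprK -[u]reprK -raddfD !F_pi FD. Qed.

End Lift.

Definition tscale (r : R) : tensor -> tensor := tlift (fun w m => tmul (r *: w) m).

Fact tscale_balanced r : balanced (fun w m => tmul (r *: w) m).
Proof.
split=> [m w w'|w m m'|w a m]; first by rewrite scalerDr tmulDl.
  exact: tmulDr.
by rewrite -scale_ract tmulA.
Qed.

Lemma tscale_tmul r w m : tscale r (tmul w m) = tmul (r *: w) m.
Proof. exact: (tlift_tmul (tscale_balanced r) w m). Qed.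

Fact tscaleA a b t : tscale a (tscale b t) = tscale (a * b) t.
Proof.
have sB r := tliftB (tscale_balanced r).
elim/tensor_ind: t => [|t u IHt IHu|w m].
- by rewrite /tscale !(tlift0 (tscale_balanced _)).
- by move: IHt IHu; rewrite /tscale !sB => -> ->.
- by rewrite !tscale_tmul scalerA.
Qed.

Fact tscale1 t : tscale 1 t = t.
Proof.
have sB r := tliftB (tscale_balanced r).
elim/tensor_ind: t => [|t u IHt IHu|w m].
- by rewrite /tscale !(tlift0 (tscale_balanced _)).
- by move: IHt IHu; rewrite /tscale !sB => -> ->.
- by rewrite !tscale_tmul scale1r.
Qed.

Fact tscaleDr a : {morph tscale a : t u / t + u}.
Proof. exact: tliftD (tscale_balanced a). Qed.

Fact tscaleDl t : {morph tscale^~ t : a b / a + b}.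
Proof.
have sB r := tliftB (tscale_balanced r).
move=> a b; elim/tensor_ind: t => [|t u IHt IHu|w m].
- by rewrite /tscale !(tlift0 (tscale_balanced _)) addr0.
- by move: IHt IHu; rewrite /tscale !sB => -> ->; rewrite opprD addrACA.
- by rewrite !tscale_tmul scalerDl tmulDl.
Qed.

HB.instance Definition _ :=
  GRing.Zmodule_isLmodule.Build R tensor tscaleA tscale1 tscaleDr tscaleDl.

Lemma tmulZ (r : R) w m : r *: tmul w m = tmul (r *: w) m.
Proof. exact: tscale_tmul. Qed.

(* The map φ ⊗ id_M followed by A ⊗_A M = M, for a right A-linear φ : X -> A. *)
Definition tcontract (phi : X -> A) : tensor -> M := tlift (fun w m => phi w *: m).

Lemma tcontract_tmul (phi : X -> A) w m :
  {morph phi : x y / x + y} -> (forall x a, phi (ract x a) = phi x * a) ->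
  tcontract phi (tmul w m) = phi w *: m.
Proof.
move=> phiD phiA; rewrite [LHS]tlift_tmul //.
split=> [m' x y|x m1 m2|x a m']; first by rewrite phiD scalerDl.
  exact: scalerDr.
by rewrite phiA scalerA.
Qed.

End Tensor.

Notation "w ⊗ m" := (tmul w m) (at level 40, left associativity) : ring_scope.

Structure semisimplicial := Semisimplicial {
  simplex :> nat -> finType;
  face : forall m, 'I_m.+2 -> simplex m.+1 -> simplex m;
  (* d_i d_(j+1) = d_j d_i for i <= j *)
  face_face : forall m (i j : 'I_m.+2) (s : simplex m.+2), (i <= j)%N ->
    face i (face (lift ord0 j) s) = face j (face (widen_ord (leqnSn _) i) s)
}.

(* The i-th vertex of an m-simplex, obtained by deleting the other vertices. *)
Fixpoint vertex (S : semisimplicial) m : S m -> 'I_m.+1 -> S 0%N :=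
  match m with
  | 0 => fun s _ => s
  | m'.+1 => fun s i =>
      if unlift ord_max i is Some j then vertex (face ord_max s) j
      else vertex (face ord0 s) ord_max
  end.

(* An n-truncated semisimplicial set is encoded with empty sets of simplices
   in the dimensions above n. *)
Structure ss_ns (n : nat) := SSns {
  ss_sort :> semisimplicial;
  ss_truncated : forall m, (n < m)%N -> #|ss_sort m| = 0%N;
  ss_vertex_inj : forall m (s t : ss_sort m), vertex s =1 vertex t -> s = t;
  ss_nonsingular : forall m (s : ss_sort m.+1), injective (vertex s)
}.

Section Calculus.
Variables (k : fieldType) (S : semisimplicial).

Definition src (e : S 1%N) : S 0%N := face ord_max e.
Definition tgt (e : S 1%N) : S 0%N := face ord0 e.

Lemma vertex_edge (e : S 1%N) :
  (vertex e ord0 = src e) * (vertex e ord_max = tgt e).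
Proof.
split; rewrite /=; last by rewrite unlift_none.
by case: unliftP => [j _|/(congr1 val)].
Qed.

Definition funAlg := {ffun S 0%N -> k}.
HB.instance Definition _ := GRing.PzRing.on funAlg.
HB.instance Definition _ := GRing.Lmodule.copy funAlg {ffun S 0%N -> k^o}.

Definition delta (v : S 0%N) : funAlg := [ffun w => (w == v)%:R].

Definition Omega1 := {ffun S 1%N -> k}.
HB.instance Definition _ := GRing.Zmodule.on Omega1.

Definition omega (e : S 1%N) : Omega1 := [ffun e' => (e' == e)%:R].

Definition Omega1_lact (f : funAlg) (w : Omega1) : Omega1 :=
  [ffun e => f (src e) * w e].

Definition Omega1_ract (w : Omega1) (g : funAlg) : Omega1 :=
  [ffun e => w e * g (tgt e)].

Fact Omega1_lactA f g w : Omega1_lact f (Omega1_lact g w) = Omega1_lact (f * g) w.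
Proof. by apply/ffunP => e; rewrite !ffunE mulrA. Qed.
Fact Omega1_lact1 w : Omega1_lact 1 w = w.
Proof. by apply/ffunP => e; rewrite !ffunE mul1r. Qed.
Fact Omega1_lactDr f : {morph Omega1_lact f : w w' / w + w'}.
Proof. by move=> w w'; apply/ffunP => e; rewrite !ffunE mulrDr. Qed.
Fact Omega1_lactDl w : {morph Omega1_lact^~ w : f g / f + g}.
Proof. by move=> f g; apply/ffunP => e; rewrite !ffunE mulrDl. Qed.
HB.instance Definition _ := GRing.Zmodule_isLmodule.Build funAlg Omega1
  Omega1_lactA Omega1_lact1 Omega1_lactDr Omega1_lactDl.

Fact Omega1_ractDl g : {morph Omega1_ract^~ g : w w' / w + w'}.
Proof. by move=> w w'; apply/ffunP => e; rewrite !ffunE mulrDl. Qed.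
Fact Omega1_ractDr w : {morph Omega1_ract w : f g / f + g}.
Proof. by move=> f g; apply/ffunP => e; rewrite !ffunE mulrDr. Qed.
Fact Omega1_ract1 w : Omega1_ract w 1 = w.
Proof. by apply/ffunP => e; rewrite !ffunE mulr1. Qed.
Fact Omega1_ractA w f g : Omega1_ract (Omega1_ract w f) g = Omega1_ract w (f * g).
Proof. by apply/ffunP => e; rewrite !ffunE mulrA. Qed.
Fact Omega1_lract f w g : Omega1_ract (f *: w) g = f *: Omega1_ract w g.
Proof. by apply/ffunP => e; rewrite !ffunE mulrA. Qed.
HB.instance Definition _ := Lmodule_isBimodule.Build funAlg funAlg Omega1
  Omega1_ractDl Omega1_ractDr Omega1_ract1 Omega1_ractA Omega1_lract.

Lemma omega_bimod (f g : funAlg) (e : S 1%N) :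
  ract (f *: omega e) g = [ffun e' => f (src e) * g (tgt e) * omega e e'].
Proof.
apply/ffunP => e'; rewrite !ffunE.
by case: eqP => [->|]; rewrite ?mulr1 ?mulr0 ?mul0r.
Qed.

Definition cst (c : k) : funAlg := [ffun=> c].

Lemma omega_basis (w : Omega1) : w = \sum_e cst (w e) *: omega e.
Proof.
apply/ffunP => e; rewrite sum_ffunE (bigD1 e) //= big1 => [|e' /negPf ne].
  by rewrite addr0 !ffunE eqxx mulr1.
by rewrite !ffunE eq_sym ne mulr0.
Qed.

Definition diff (f : funAlg) : Omega1 := [ffun e => f (tgt e) - f (src e)].

Lemma diffE f : diff f = \sum_e cst (f (tgt e) - f (src e)) *: omega e.
Proof. by rewrite [LHS]omega_basis; apply: eq_bigr => e _; rewrite ffunE. Qed.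

Definition phi (e : S 1%N) (w : Omega1) : funAlg := w e *: delta (tgt e).

Lemma phi_omega e e' : phi e (omega e') = if e' == e then delta (tgt e) else 0.
Proof.
rewrite /phi ffunE eq_sym; by case: eqP => _; rewrite ?scale1r ?scale0r.
Qed.

Lemma phiD e : {morph phi e : w w' / w + w'}.
Proof. by move=> w w'; rewrite /phi ffunE scalerDl. Qed.

Lemma phi_ract e w f : phi e (ract w f) = phi e w * f.
Proof.
apply/ffunP => v; rewrite !ffunE.
by case: eqP => [->|_]; rewrite /GRing.scale /= ?mulr1 ?mulr0 ?mul0r.
Qed.

Definition partial (e : S 1%N) (f : funAlg) : funAlg := phi e (diff f).

(* The underlying vector space of a left module over the function algebra, by
   restriction of scalars along cst. *)
Definition restr (M : lmodType funAlg) : Type := M.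

Section Restriction.
Variable M : lmodType funAlg.
HB.instance Definition _ := GRing.Zmodule.on (restr M).

Definition rscale (c : k) (x : restr M) : restr M := cst c *: (x : M).

Fact rscaleA a b x : rscale a (rscale b x) = rscale (a * b) x.
Proof.
rewrite /rscale scalerA; congr (_ *: _).
by apply/ffunP => v; rewrite !ffunE.
Qed.
Fact rscale1 x : rscale 1 x = x.
Proof. by rewrite /rscale -[RHS]scale1r; congr (_ *: _). Qed.
Fact rscaleDr a : {morph rscale a : x y / x + y}.
Proof. exact: scalerDr. Qed.
Fact rscaleDl x : {morph rscale^~ x : a b / a + b}.
Proof.
move=> a b; rewrite /rscale -scalerDl; congr (_ *: _).
by apply/ffunP => v; rewrite !ffunE.
Qed.
HB.instance Definition _ := GRing.Zmodule_isLmodule.Build k (restr M)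
  rscaleA rscale1 rscaleDr rscaleDl.

Lemma restr_scaleE (c : k) (x : M) : c *: (x : restr M) = cst c *: x.
Proof. by []. Qed.

End Restriction.

Section Modules.
Variable M : lmodType funAlg.

Definition finite_dimensional : Prop :=
  exists n, exists2 f : restr M -> 'rV[k]_n, linear f & bijective f.

(* Membership in M_v = delta_v M. *)
Definition in_comp (v : S 0%N) : pred (restr M) :=
  fun x => `[< exists y : M, x = delta v *: y >].

Fact in_comp_closed v : submod_closed (in_comp v).
Proof.
split=> [|c _ _ /asboolP[x ->] /asboolP[y ->]]; apply/asboolP.
  by exists 0; rewrite scaler0.
exists (cst c *: x + y); rewrite scalerDr scalerA.
have -> : delta v * cst c = cst c * delta v.
  by apply/ffunP => w; rewrite !ffunE mulrC.
by rewrite -scalerA.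
Qed.
HB.instance Definition _ v :=
  GRing.isSubmodClosed.Build k (restr M) (in_comp v) (in_comp_closed v).

Record component (v : S 0%N) :=
  Component { component_val :> restr M; _ : in_comp v component_val }.
HB.instance Definition _ v := [isSub for @component_val v].
HB.instance Definition _ v := [Choice of component v by <:].
HB.instance Definition _ v := [SubChoice_isSubLmodule of component v by <:].

Fact proj_subproof v (x : M) : in_comp v (delta v *: x).
Proof. by apply/asboolP; exists x. Qed.
Definition proj v (x : M) : component v := Component (proj_subproof v x).

Definition left_connection (nabla : M -> tensor Omega1 M) : Prop :=
  linear (nabla : restr M -> restr (tensor Omega1 M)) /\
  forall (f : funAlg) (x : M), nabla (f *: x) = diff f ⊗ x + f *: nabla x.

(* T_e = (phi^e ⊗ id_M) o nabla. *)
Definition connT (nabla : M -> tensor Omega1 M) (e : S 1%N) (x : M) : M :=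
  tcontract (phi e) (nabla x).

End Modules.
End Calculus.

(* Main.v *)
From HB Require Import structures.
Require Import Defs.
From mathcomp Require Import all_boot all_order all_algebra.
From mathcomp Require Import boolp.

Import GRing.Theory.
Local Open Scope ring_scope.

(* An element [t] of the tensor product is recovered from its contractions as
   the sum of [omega e ⊗ tcontract (phi e) t]: it suffices to see this on pure
   tensors, where it is the basis expansion in Omega^1. Contracting the Leibniz
   rule gives the twisted Leibniz rule for T_e; at f = delta_(src e), because
   an edge has distinct endpoints, it reads T_e x = delta_(tgt e) x +
   T_e (delta_(src e) x), so R_e is minus the restriction of T_e to
   M_(src e). *)

(** * Zero, differences and finite sums in a tensor product *)

Section TensorAdditivity.
Variables (R A : pzRingType) (X : bimodType R A) (M : lmodType A).

Lemma tmul0 (w : X) : w ⊗ (0 : M) = 0.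
Proof. by apply: (addIr (w ⊗ 0)); rewrite -tmulDr !add0r. Qed.

Lemma tmul0l (m : M) : (0 : X) ⊗ m = 0.
Proof. by apply: (addIr (0 ⊗ m)); rewrite -tmulDl !add0r. Qed.

Lemma tmulB (w : X) (m m' : M) : w ⊗ (m - m') = w ⊗ m - w ⊗ m'.
Proof. by apply: (addIr (w ⊗ m')); rewrite -tmulDr !subrK. Qed.

Lemma tmul_suml (I : finType) (w : I -> X) (m : M) :
  (\sum_i w i) ⊗ m = \sum_i w i ⊗ m.
Proof.
apply: (big_morph (fun w => w ⊗ m)); last exact: tmul0l.
by move=> ? ?; rewrite tmulDl.
Qed.

End TensorAdditivity.

(** * Vertex idempotents, components, and edge generators *)

Section Connections.
Variables (k : fieldType) (S : semisimplicial) (M : lmodType (funAlg k S)).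
Implicit Types (e : S 1%N) (v : S 0%N) (f : funAlg k S) (x y : M).

Notation tens := (tensor (Omega1 k S) M).

(** Hence [f] acts on the component at [v] through the scalar [f v], so scalars of the function
    algebra can be traded for constants. *)
Lemma delta_mul f v : delta k v * f = cst S (f v) * delta k v.
Proof.
by apply/ffunP => w; rewrite !ffunE; case: eqP => [->|_];
   rewrite ?mulr0 ?mul0r // mulrC.
Qed.

Lemma delta_idem v : delta k v * delta k v = delta k v.
Proof. by apply/ffunP => w; rewrite !ffunE; case: eqP; rewrite ?mulr0 ?mulr1. Qed.

Lemma in_compP v (x : M) : in_comp v x -> delta k v *: x = x.
Proof. by case/asboolP=> y ->; rewrite scalerA delta_idem. Qed.

Lemma in_comp_ortho v w (x : M) : v != w -> in_comp v x -> delta k w *: x = 0.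
Proof.
move=> /negPf ne /asboolP[y ->]; rewrite scalerA delta_mul ffunE eq_sym ne.
by rewrite (_ : cst S 0 = 0) ?mul0r ?scale0r //; apply/ffunP => u; rewrite !ffunE.
Qed.

Lemma lact_omega f e : f *: omega k e = cst S (f (src e)) *: omega k e.
Proof.
by apply/ffunP => e'; rewrite !ffunE; case: eqP => [->|_]; rewrite ?mulr0.
Qed.

Lemma ract_omega f e : ract (omega k e) f = cst S (f (tgt e)) *: omega k e.
Proof.
by apply/ffunP => e'; rewrite !ffunE; case: eqP => [->|_];
   rewrite ?mulr0 ?mul0r // mulrC.
Qed.

Lemma omega_tensZ e f x : omega k e ⊗ (f *: x) = cst S (f (tgt e)) *: omega k e ⊗ x.
Proof. by rewrite -tmulA ract_omega. Qed.

Lemma omega_tens_cst e (c : k) x :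
  omega k e ⊗ (cst S c *: x) = cst S c *: (omega k e ⊗ x).
Proof. by rewrite omega_tensZ ffunE tmulZ. Qed.

(** Only the component at [tgt e] survives to the right of [omega k e]; this is why coefficients
    must be confined to that component to be unique. *)
Lemma omega_tens_delta e x : omega k e ⊗ (delta k (tgt e) *: x) = omega k e ⊗ x.
Proof.
rewrite omega_tensZ; congr (_ ⊗ _).
by rewrite ffunE eqxx; apply: scale1r.
Qed.

(** * Contractions along edges and the expansion of a tensor *)

Lemma phi_balanced e :
  balanced (fun (w : Omega1 k S) (m : M) => phi e w *: m).
Proof.
split=> [m w w'|w m m'|w a m]; first by rewrite phiD scalerDl.
  exact: scalerDr.
by rewrite phi_ract scalerA.
Qed.

Lemma contract_tmul e w x : tcontract (phi e) (w ⊗ x) = phi e w *: x.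
Proof. exact: tcontract_tmul (@phiD _ _ e) (@phi_ract _ _ e). Qed.

Lemma contractB e (t u : tens) :
  tcontract (phi e) (t - u) = tcontract (phi e) t - tcontract (phi e) u.
Proof. exact: tliftB (phi_balanced e) t u. Qed.

Lemma contractD e (t u : tens) :
  tcontract (phi e) (t + u) = tcontract (phi e) t + tcontract (phi e) u.
Proof. exact: tliftD (phi_balanced e) t u. Qed.

Lemma contract0 e : tcontract (phi e) (0 : tens) = 0.
Proof. exact: tlift0 (phi_balanced e). Qed.

Lemma contract_sum e (I : finType) (t : I -> tens) :
  tcontract (phi e) (\sum_i t i) = \sum_i tcontract (phi e) (t i).
Proof. by apply: (big_morph _ (contractD e) (contract0 e)). Qed.

Lemma phi_lact e f (w : Omega1 k S) :
  phi e (f *: w) = cst S (f (src e)) * phi e w.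
Proof. by apply/ffunP => v; rewrite !ffunE /GRing.scale /= mulrA. Qed.

(** The left action weights an edge by the value at its source, whereas [phi e] lands at the target;
    so [f] leaves the contraction as the constant [f (src e)]. *)
Lemma contractZ e f (t : tens) :
  tcontract (phi e) (f *: t) = cst S (f (src e)) *: tcontract (phi e) t.
Proof.
elim/tensor_ind: t => [|t u IHt IHu|w m].
- by rewrite scaler0 contract0 scaler0.
- by rewrite scalerBr !contractB IHt IHu scalerBr.
- by rewrite tmulZ !contract_tmul phi_lact scalerA.
Qed.

Lemma phiE e (w : Omega1 k S) : phi e w = delta k (tgt e) * cst S (w e).
Proof.
by apply/ffunP => v; rewrite !ffunE /GRing.scale /= mulrC.
Qed.

Lemma in_comp_contract e (t : tens) : in_comp (tgt e) (tcontract (phi e) t).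
Proof.
apply/asboolP; exists (tcontract (phi e) t).
elim/tensor_ind: t => [|t u IHt IHu|w m].
- by rewrite contract0 scaler0.
- by rewrite contractB scalerBr -IHt -IHu.
- by rewrite contract_tmul scalerA phiE mulrA delta_idem.
Qed.

Lemma tens_expansion (t : tens) :
  t = \sum_e omega k e ⊗ tcontract (phi e) t.
Proof.
(* Each induction hypothesis has its tensor on both sides, so only the first occurrence is
   expanded. *)
elim/tensor_ind: t => [|t u {1}-> {1}->|w m].
- by rewrite big1 // => e _; rewrite contract0 tmul0.
- by rewrite -sumrB; apply: eq_bigr => e _; rewrite contractB tmulB.
rewrite {1}[w]omega_basis tmul_suml; apply: eq_bigr => e _.
rewrite contract_tmul phiE -scalerA omega_tens_delta.
by rewrite omega_tensZ ffunE.
Qed.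

(** [phi e] kills every other generator and leaves [delta k (tgt e) *: y e], which is [y e] by the
    component hypothesis. *)
Lemma contract_expansion (y : S 1%N -> M) e :
  in_comp (tgt e) (y e) ->
  tcontract (phi e) (\sum_e' omega k e' ⊗ y e') = y e.
Proof.
move=> ye; rewrite contract_sum (bigD1 e) //= big1 => [|e' /negPf ne].
  by rewrite contract_tmul phi_omega eqxx addr0 in_compP.
by rewrite contract_tmul phi_omega ne scale0r.
Qed.

Lemma partialE e f : partial e f = (f (tgt e) - f (src e)) *: delta k (tgt e).
Proof. by rewrite /partial /phi ffunE. Qed.

(** * From a connection to its edge transports *)

Section OneConnection.
Variable nabla : M -> tens.
Hypothesis nablaP : left_connection nabla.

Lemma connTZ e f x :
  connT nabla e (f *: x) =
  partial e f *: x + cst S (f (src e)) *: connT nabla e x.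
Proof.
by case: nablaP => _ /(_ f x) E; rewrite /connT E contractD contract_tmul contractZ.
Qed.

Lemma connT_linear e (c : k) x y :
  connT nabla e (cst S c *: x + y) = cst S c *: connT nabla e x + connT nabla e y.
Proof.
case: nablaP => /(_ c x y) E _.
by rewrite /connT [nabla _]E contractD contractZ ffunE.
Qed.

Lemma connT_src e x : src e != tgt e ->
  connT nabla e x = delta k (tgt e) *: x + connT nabla e (delta k (src e) *: x).
Proof.
(* For [f = delta k (src e)], [f (tgt e) = 0] and [f (src e) = 1], so the derivative term is
   [- delta k (tgt e) *: x] and cancels. *)
move=> /negPf ne; rewrite connTZ partialE !ffunE eqxx eq_sym ne sub0r.
by rewrite scaleN1r scaleNr addrA subrr add0r; apply/esym/scale1r.
Qed.

(** The projection changes no value, since contractions already lie in the target component; it only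
    supplies the membership proof. *)
Definition transport e (y : component M (src e)) : component M (tgt e) :=
  proj (tgt e) (- connT nabla e (component_val y)).

Lemma val_transport e (y : component M (src e)) :
  component_val (transport e y) = - connT nabla e (component_val y).
Proof.
rewrite /= scalerN; congr (- _); apply: in_compP; exact: in_comp_contract.
Qed.

Fact transport_linear e : linear (transport e).
Proof.
move=> c x y; apply: val_inj; rewrite [LHS]val_transport.
rewrite [RHS]linearP [RHS](congr2 (fun u v : restr M => c *: u + v)
  (val_transport e x) (val_transport e y)).
rewrite scalerN -opprD; congr (- _); exact: connT_linear.
Qed.

Definition transport_lin e : {linear component M (src e) -> component M (tgt e)} :=
  HB.pack (transport e) (GRing.isLinear.Build k _ _ *:%R (transport e)
    (transport_linear e)).

End OneConnection.

Lemma proj_component v (y : component M v) : proj v (component_val y) = y.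
Proof. by apply: val_inj; apply: in_compP; case: y. Qed.

(** * From edge transports to a connection *)

Section FromTransport.
Variable R : forall e, {linear component M (src e) -> component M (tgt e)}.

Definition edge_diff e x : M :=
  delta k (tgt e) *: x - component_val (R e (proj (src e) x)).

Definition transport_conn x : tens := \sum_e omega k e ⊗ edge_diff e x.

Lemma proj_linear v (c : k) x y :
  proj v (cst S c *: x + y) = c *: proj v x + proj v y.
Proof.
apply: val_inj; rewrite [RHS]linearP.
rewrite [LHS]scalerDr scalerA delta_mul ffunE -scalerA; reflexivity.
Qed.

Lemma projZ v f x : proj v (f *: x) = f v *: proj v x.
Proof. by apply: val_inj; rewrite [RHS]linearZ [LHS]scalerA delta_mul -scalerA. Qed.

Lemma edge_diff_linear e (c : k) x y :
  edge_diff e (cst S c *: x + y) = cst S c *: edge_diff e x + edge_diff e y.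
Proof.
rewrite /edge_diff proj_linear linearP scalerDr scalerA delta_mul ffunE -scalerA.
by rewrite scalerBr addrACA -opprD.
Qed.

(** [f] scales the target term by [f (tgt e)] and the transported term by [f (src e)]; writing the
    former as the increment plus [f (src e)] isolates the derivative. *)
Lemma edge_diffZ e f x :
  edge_diff e (f *: x) =
  cst S (f (tgt e) - f (src e)) *: (delta k (tgt e) *: x) +
  cst S (f (src e)) *: edge_diff e x.
Proof.
rewrite /edge_diff projZ linearZ scalerA delta_mul -scalerA scalerBr addrA.
rewrite -scalerDl; congr (_ *: _ - _).
by apply/ffunP => v; rewrite !ffunE subrK.
Qed.

Lemma transport_connP : left_connection transport_conn.
Proof.
split=> [c x y|f x].
  rewrite /transport_conn [_ *: (\sum_e _)]scaler_sumr -big_split.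
  by apply: eq_bigr => e _; rewrite edge_diff_linear tmulDr omega_tens_cst.
(* The Leibniz rule is checked edge by edge: the increment gives the [diff f] term, and [f] acts on
   [omega k e] as [f (src e)]. *)
rewrite /transport_conn diffE tmul_suml scaler_sumr -big_split.
apply: eq_bigr => e _ /=.
rewrite edge_diffZ tmulDr !omega_tens_cst omega_tens_delta; congr (_ + _).
  exact: tmulZ.
by rewrite !tmulZ [f *: _]lact_omega.
Qed.

End FromTransport.

End Connections.

(** Source and target are vertices 0 and 1 of the edge, distinct by nonsingularity. *)
Lemma src_neq_tgt n (S : ss_ns n) (e : S 1%N) : src e != tgt e.
Proof.
rewrite -!vertex_edge; apply/eqP => /(@ss_nonsingular _ S 0).
by move/(congr1 val).
Qed.

Theorem proposition5p7 (k : fieldType) (n : nat) (S : ss_ns n)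
    (M : lmodType (funAlg k S)) :
  2%N \notin [pchar k] ->
  finite_dimensional M ->
  (forall nabla : M -> tensor (Omega1 k S) M, left_connection nabla ->
    [/\ forall x : M,
          [/\ nabla x = \sum_(e : S 1%N) omega k e ⊗ connT nabla e x,
              forall e : S 1%N, in_comp (tgt e) (connT nabla e x)
            & forall y : S 1%N -> M,
                (forall e : S 1%N, in_comp (tgt e) (y e)) ->
                nabla x = \sum_(e : S 1%N) omega k e ⊗ y e ->
                forall e : S 1%N, y e = connT nabla e x],
        forall (e : S 1%N) (f : funAlg k S),
          partial e f = (f (tgt e) - f (src e)) *: delta k (tgt e) /\
          forall x : M,
            connT nabla e (f *: x) =
              partial e f *: x + f (src e) *: (connT nabla e x : restr M)
      & forall e : S 1%N,
          exists R : {linear component M (src e) -> component M (tgt e)},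
            (forall x : M, connT nabla e x =
               delta k (tgt e) *: x - component_val (R (proj (src e) x))) /\
            forall R' : {linear component M (src e) -> component M (tgt e)},
              (forall x : M, connT nabla e x =
                 delta k (tgt e) *: x - component_val (R' (proj (src e) x))) ->
              R' =1 R]) /\
  (forall R : forall e : S 1%N,
      {linear component M (src e) -> component M (tgt e)},
    exists! nabla : M -> tensor (Omega1 k S) M,
      left_connection nabla /\
      forall x : M, nabla x =
        \sum_(e : S 1%N)
          omega k e ⊗ (delta k (tgt e) *: x - component_val (R e (proj (src e) x)))).
Proof.
move=> _ _; split=> [nabla nablaP|R].
  split=> [x|e f|e].
  - split=> [|e|y yP E e]; first exact: tens_expansion.
      exact: in_comp_contract.
    by rewrite /connT E contract_expansion.
  - by split=> [|x]; [exact: partialE | exact: connTZ].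
  - exists (transport_lin _ _ _ nabla nablaP e); split=> [x|R' R'P y].
      by rewrite val_transport opprK; apply: connT_src => //; apply: src_neq_tgt.
    (* On [y] in the source component the term [delta k (tgt e) *: y] vanishes by orthogonality, so
       the formula forces [R' y] to be minus [T_e y]. *)
    apply: val_inj; rewrite [RHS]val_transport R'P proj_component.
    by rewrite (in_comp_ortho _ _ _ _ _ _ (src_neq_tgt _ _ e) (valP y)) sub0r opprK.
exists (transport_conn _ _ _ R); split; first by split=> //; apply: transport_connP.
by move=> nabla [_ E]; apply/funext => x; rewrite E.
Qed.
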